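(* Let $K$ be a field, and let $G_1$ and $G_2$ be connected finite simple graphs on the vertex sets $[m]$ and $[n]$, respectively. (a) Let $P$ be a minimal prime ideal of the binomial edge ideal $J_{G_1,G_2}$. Then there exists a set $W\subset[m]\times[n]$ which is admissible with respect to $(G_1,G_2)$ such that $P=P_W$. (b) Let $W\subset [m]\times[n]$ be an admissible set with respect to $(G_1,G_2)$. Then $P_W$ is a minimal prime ideal of $J_{G_1,G_2}$ if and only if for any admissible set $V\subset[m]\times[n]$ properly contained in $W$ there exists $e\times f\in\widehat{V}^c\setminus\widehat{W}^c$ such that no edge of $e\times f$ is contained in $W$.
   Context: $[m]=\{1,\ldots,m\}$. $X=(x_{ij})$ is an $m\times n$ matrix of indeterminates, $K[X]$ the polynomial ring in its entries. For $e=\{i,j\}$ with $1\le i<j\le m$ and $f=\{k,l\}$ with $1\le k<l\le n$ put $p_{e,f}=x_{ik}x_{jl}-x_{il}x_{jk}$, and $J_{G_1,G_2}=(p_{e,f}: e\in E(G_1), f\in E(G_2))\subset K[X]$. A subset $W\subset[m]\times[n]$ is admissible with respect to $(G_1,G_2)$ if whenever $(i,j)\in (e\times f)\cap W$ for some $e\in E(G_1)$ and $f\in E(G_2)$, then $\{i\}\times f\subset W$ or $e\times\{j\}\subset W$. For two-element sets $e=\{i,j\}\subset[m]$ and $f=\{k,l\}\subset[n]$, the edges of $e\times f$ are the four sets $\{i\}\times f$, $\{j\}\times f$, $e\times\{k\}$, $e\times\{l\}$. For an admissible set $W$ let $W^c=\{e\times f: e\in E(G_1), f\in E(G_2), W\cap(e\times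 f)=\emptyset\}$ (regarded as a subset of $E(G_1)\times E(G_2)$). A subset $E\subset E(G_1)\times E(G_2)$ is connected if for all $e\times f$ and $e'\times f'$ in $E$ there exist $e_i\times f_i\in E$, $i=1,\ldots,r$, with $e\times f=e_1\times f_1$, $e'\times f'=e_r\times f_r$ and $(e_i\times f_i)\cap(e_{i+1}\times f_{i+1})\neq\emptyset$ for $i=1,\ldots,r-1$; every subset is uniquely a disjoint union of its connected components. Each connected component $C_i$ of $W^c$ is of the form $C_i=E(G_{1i})\times E(G_{2i})$ with connected subgraphs $G_{1i}\subset G_1$, $G_{2i}\subset G_2$ (whose vertices are the endpoints of their edges). For a graph $G$, $\widehat{G}$ denotes the complete graph on $V(G)$. Define $\widehat{W}^c=\bigsqcup_i E(\widehat{G}_{1i})\times E(\widehat{G}_{2i})$, the union over all connected components $C_i$ of $W^c$, and $$P_W=(\{x_{ij}:(i,j)\in W\})+Q_W,\qquad Q_W=(p_{e,f}: e\times f\in\widehat{W}^c),$$ which is a prime ideal of $K[X]$. *)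

(* Defs.v *)
From HB Require Import structures.
From mathcomp Require Import all_boot all_order all_algebra ring_quotient.
From mathcomp Require Import boolp.
From mathcomp Require Import mpoly.

Set Implicit Arguments.
Unset Strict Implicit.
Unset Printing Implicit Defensive.

Import GRing.Theory.

Local Open Scope ring_scope.

(* Ideals are boolean membership predicates, as in ring_quotient; the
   undecidable ones are booleanized with [asbool]. *)

Definition ideal_gen (R : comNzRingType) (A : R -> Prop) : {pred R} :=
  [pred x | `[< exists2 s : seq (R * R),
                  (forall u, u \in s -> A u.2)
                  & x = \sum_(u <- s) u.1 * u.2 >]].

Definition ideal_add (R : comNzRingType) (I J : {pred R}) : {pred R} :=
  [pred x | `[< exists2 y, y \in I & exists2 z, z \in J & x = y + z >]].

(* [idealr_closed] already includes properness. *)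
Definition prime_ideal (R : comNzRingType) (P : {pred R}) : Prop :=
  idealr_closed P /\ prime_idealr_closed P.

Definition minimal_prime_ideal (R : comNzRingType) (J P : {pred R}) : Prop :=
  [/\ prime_ideal P,
      {subset J <= P}
    & forall Q : {pred R}, prime_ideal Q -> {subset J <= Q} ->
        {subset Q <= P} -> Q =i P].

Record sgraph (T : finType) := SGraph {
  adj :> rel T;
  adj_sym : ssrbool.symmetric adj;
  adj_irrefl : irreflexive adj
}.

Definition edges (T : finType) (G : sgraph T) : {set {set T}} :=
  [set [set u.1; u.2] | u : T * T & G u.1 u.2].

Definition connected_graph (T : finType) (G : sgraph T) : Prop :=
  (0 < #|T|)%N /\ forall u v : T, connect G u v.

(* Edge set of the complete graph on A. *)
Definition complete_edges (T : finType) (A : {set T}) : {set {set T}} :=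
  [set e : {set T} | (e \subset A) && (#|e| == 2)].

(* The vertex set [m] is 'I_m, shifted to start at 0.  The set e x f with
   e \subset [m], f \subset [n] is represented by the pair (e, f) when it is
   an element of E(G1) x E(G2), and by [setX e f] when it is a subset of
   [m] x [n]. *)

Definition box_edges (m n : nat) (e : {set 'I_m}) (f : {set 'I_n})
    : {set {set 'I_m * 'I_n}} :=
  [set setX [set i] f | i in e] :|: [set setX e [set j] | j in f].

Definition admissible (m n : nat) (G1 : sgraph 'I_m) (G2 : sgraph 'I_n)
    (W : {set 'I_m * 'I_n}) : Prop :=
  forall (e : {set 'I_m}) (f : {set 'I_n}),
    e \in edges G1 -> f \in edges G2 ->
    forall (i : 'I_m) (j : 'I_n), (i, j) \in setX e f :&: W ->
      setX [set i] f \subset W \/ setX e [set j] \subset W.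

Definition Wcompl (m n : nat) (G1 : sgraph 'I_m) (G2 : sgraph 'I_n)
    (W : {set 'I_m * 'I_n}) : {set {set 'I_m} * {set 'I_n}} :=
  [set ef in setX (edges G1) (edges G2) | W :&: setX ef.1 ef.2 == set0].

Definition meets_in (m n : nat) (E : {set {set 'I_m} * {set 'I_n}})
    : rel ({set 'I_m} * {set 'I_n}) :=
  fun a b => [&& a \in E, b \in E & setX a.1 a.2 :&: setX b.1 b.2 != set0].

Definition components (m n : nat) (E : {set {set 'I_m} * {set 'I_n}})
    : {set {set {set 'I_m} * {set 'I_n}}} :=
  equivalence_partition (connect (meets_in E)) E.

(* A component C of W^c is E(G1i) x E(G2i), so E(G1i) and E(G2i) are the two
   projections of C, and V(G1i), V(G2i) are the unions of their elements. *)
Definition Wcompl_hat (m n : nat) (G1 : sgraph 'I_m) (G2 : sgraph 'I_n)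
    (W : {set 'I_m * 'I_n}) : {set {set 'I_m} * {set 'I_n}} :=
  \bigcup_(C in components (Wcompl G1 G2 W))
    setX (complete_edges (cover [set c.1 | c in C]))
         (complete_edges (cover [set c.2 | c in C])).

(* K[X] has its m * n variables indexed by 'I_m * 'I_n via [mxvec_index]. *)
Definition genmx (K : fieldType) (m n : nat) : 'M[{mpoly K[m * n]}]_(m, n) :=
  \matrix_(i, j) 'X_(mxvec_index i j).

Definition minor2 (R : comNzRingType) (m n : nat) (X : 'M[R]_(m, n))
    (i j : 'I_m) (k l : 'I_n) : R :=
  X i k * X j l - X i l * X j k.

Definition binomial_ideal (K : fieldType) (m n : nat)
    (E : {set {set 'I_m} * {set 'I_n}}) : {pred {mpoly K[m * n]}} :=
  ideal_gen (fun p => exists (i j : 'I_m) (k l : 'I_n),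
    [/\ (i < j)%N, (k < l)%N, ([set i; j], [set k; l]) \in E
      & p = minor2 (genmx K m n) i j k l]).

Arguments binomial_ideal K {m n} E _.

Definition edge_ideal (K : fieldType) (m n : nat)
    (G1 : sgraph 'I_m) (G2 : sgraph 'I_n) : {pred {mpoly K[m * n]}} :=
  binomial_ideal K (setX (edges G1) (edges G2)).

Arguments edge_ideal K {m n} G1 G2 _.

Definition PW (K : fieldType) (m n : nat) (G1 : sgraph 'I_m)
    (G2 : sgraph 'I_n) (W : {set 'I_m * 'I_n}) : {pred {mpoly K[m * n]}} :=
  ideal_add
    (ideal_gen (fun p => exists i j, (i, j) \in W /\ p = genmx K m n i j))
    (binomial_ideal K (Wcompl_hat G1 G2 W)).

Arguments PW K {m n} G1 G2 W _.

(* Main.v *)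
(** Number the connected components of [W^c] and let [A_c x B_c] be the cells
    covered by the c-th one; admissibility makes these disjoint rectangles.
    View every remaining cell outside [W] as a 1 x 1 rectangle.  Then [P_W] is
    the kernel of the monomial map sending [x_ij] to [0] on [W] and to
    [y_(i,c) * z_(j,c)] on [A_c x B_c]: two monomials with the same nonzero
    image are linked by 2 x 2 exchanges, each a multiple of a minor in [P_W].
    Hence [P_W] is prime, it contains no variable outside [W], and it contains
    [p_{e,f}] only if [(e,f)] lies in the completion of [W^c] or [W] contains an
    edge of [e x f].  Conversely, if [P] is a prime containing the edge ideal,
    then [W = {(i,j) | x_ij \in P}] is admissible, and cancelling variables
    outside [P] along paths shows [P_W <= P].  Both parts of the theorem are
    comparisons between the primes [P_W]. *)

Require Import Defs.
From mathcomp Require Import all_boot all_order all_algebra ring_quotient.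
From mathcomp Require Import boolp.
From mathcomp Require Import mpoly ring zify.

Set Implicit Arguments.
Unset Strict Implicit.
Unset Printing Implicit Defensive.

(** * Ideals, generated ideals and sums of ideals *)

Section Ideals.

Import GRing.Theory.
Local Open Scope ring_scope.

Variable R : comNzRingType.
Implicit Types (A : R -> Prop) (S I J : {pred R}).

(* Unlike [idealr_closed], this does not include properness. *)
Definition is_ideal S :=
  0 \in S /\ forall a, {in S &, forall u v, a * u + v \in S}.

Lemma idealr_is_ideal S : idealr_closed S -> is_ideal S.
Proof. by case. Qed.

Lemma is_idealD S x y : is_ideal S -> x \in S -> y \in S -> x + y \in S.
Proof. by move=> [_ S_lin] xS yS; rewrite -[x]mul1r S_lin. Qed.

Lemma is_idealM S a x : is_ideal S -> x \in S -> a * x \in S.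
Proof. by move=> [S0 S_lin] xS; rewrite -[_ * _]addr0 S_lin. Qed.

Lemma is_idealN S x : is_ideal S -> x \in S -> - x \in S.
Proof. by move=> S_id xS; rewrite -mulN1r is_idealM. Qed.

Lemma is_idealB S x y : is_ideal S -> x \in S -> y \in S -> x - y \in S.
Proof. by move=> S_id xS yS; rewrite is_idealD ?is_idealN. Qed.

Lemma is_ideal_sum S (T : eqType) (r : seq T) (F : T -> R) :
  is_ideal S -> (forall i, i \in r -> F i \in S) -> \sum_(i <- r) F i \in S.
Proof.
move=> S_id FS; rewrite big_seq; apply: (big_ind (fun x => x \in S)) => //.
- by case: S_id.
- by move=> x y xS yS; apply: is_idealD.
Qed.

Lemma ideal_gen_is_ideal A : is_ideal (ideal_gen A).
Proof.
split; first by apply/asboolP; exists [::]; rewrite ?big_nil.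
move=> a u v /asboolP[s sA ->] /asboolP[t tA ->]; apply/asboolP.
exists ([seq (a * w.1, w.2) | w <- s] ++ t).
  move=> w; rewrite mem_cat => /orP[/mapP[z zs ->] /=|]; last exact: tA.
  exact: sA.
rewrite big_cat big_map mulr_sumr; congr (_ + _).
by apply: eq_bigr => w _; rewrite mulrA.
Qed.

Lemma mem_ideal_gen A x : A x -> x \in ideal_gen A.
Proof.
move=> Ax; apply/asboolP; exists [:: (1, x)]; last by rewrite big_seq1 mul1r.
by move=> u; rewrite inE => /eqP ->.
Qed.

Lemma ideal_gen_sub A S :
  is_ideal S -> (forall x, A x -> x \in S) -> {subset ideal_gen A <= S}.
Proof.
move=> S_id AS x /asboolP[s sA ->]; apply: is_ideal_sum => // u us.
exact/is_idealM/AS/sA.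
Qed.

Lemma ideal_add_is_ideal I J :
  is_ideal I -> is_ideal J -> is_ideal (ideal_add I J).
Proof.
move=> I_id J_id; split.
  apply/asboolP; exists 0; first by case: I_id.
  by exists 0; rewrite ?addr0 //; case: J_id.
move=> a u v /asboolP[y yI [z zJ ->]] /asboolP[y' y'I [z' z'J ->]].
apply/asboolP; exists (a * y + y'); first by case: I_id => _; apply.
exists (a * z + z'); first by case: J_id => _; apply.
by rewrite mulrDr addrACA.
Qed.

Lemma sub_ideal_addl I J : is_ideal J -> {subset I <= ideal_add I J}.
Proof.
case=> J0 _ x xI; apply/asboolP; exists x => //.
by exists 0; rewrite ?addr0.
Qed.

Lemma sub_ideal_addr I J : is_ideal I -> {subset J <= ideal_add I J}.
Proof.
case=> I0 _ x xJ; apply/asboolP; exists 0 => //.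
by exists x; rewrite ?add0r.
Qed.

Lemma ideal_add_sub I J S : is_ideal S ->
  {subset I <= S} -> {subset J <= S} -> {subset ideal_add I J <= S}.
Proof.
move=> S_id IS JS x /asboolP[y /IS yS [z /JS zS ->]].
exact: is_idealD.
Qed.

End Ideals.

(** * Kernels of monomial maps with two parameters per variable *)

Section ToricKernel.

Import GRing.Theory.
Local Open Scope ring_scope.

Variables (K : fieldType) (N M : nat) (bad : pred 'I_N) (a b : 'I_N -> 'I_M).

Definition toric_map : {rmorphism {mpoly K[N]} -> {mpoly K[M]}} :=
  mmap (@mpolyC M K) (fun i => if bad i then 0 else 'X_(a i) * 'X_(b i)).

(** The exponent vector of the image of a good monomial. With u read as a table of multiplicities,
    it lists the row and column sums, one for each parameter. *)
Definition margin (u : 'X_{1..N}) : 'X_{1..M} :=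
  (\sum_i (U_(a i) + U_(b i)) *+ u i)%MM.

Definition good (u : 'X_{1..N}) := [forall i, bad i ==> (u i == 0%N)].

Lemma toric_map_var i :
  toric_map 'X_i = if bad i then 0 else 'X_[U_(a i) + U_(b i)].
Proof. by rewrite /= mmapX mmap1U mpolyXD. Qed.

Lemma toric_mapX u : toric_map 'X_[u] = if good u then 'X_[margin u] else 0.
Proof.
rewrite /= mmapX /mmap1; case: ifP => [/forallP gu | /forallPn[i]].
  rewrite /margin -mprodXnE; apply: eq_bigr => i _.
  have := gu i; case: (bad i) => /= [/eqP ->|_]; first by rewrite !expr0.
  by rewrite -mpolyXD.
rewrite negb_imply => /andP[bi ui]; rewrite (bigD1 i) //= bi expr0n.
by rewrite (negPf ui) mul0r.
Qed.

Lemma toric_mapZ c p : toric_map (c *: p) = c *: toric_map p.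
Proof. by rewrite /= mmapZ mul_mpolyC. Qed.

Lemma margin0 : margin 0 = 0%MM.
Proof. by rewrite /margin big1 // => i _; rewrite mnm0E mulm0n. Qed.

Lemma marginD u v : margin (u + v) = (margin u + margin v)%MM.
Proof.
apply/mnmP=> y; rewrite mnmDE !mnm_sumE -big_split; apply: eq_bigr => i _ /=.
by rewrite !mulmnE (mnmDE i u) mulnDr.
Qed.

Lemma margin1 i : margin U_(i) = (U_(a i) + U_(b i))%MM.
Proof.
rewrite /margin (bigD1 i) //= mnm1E eqxx mulm1n big1 ?addm0 // => j ji.
by rewrite mnm1E eq_sym (negPf ji) mulm0n.
Qed.

Lemma goodD u v : good (u + v) = good u && good v.
Proof.
apply/forallP/andP => [g|[/forallP gu /forallP gv] i].
  split; apply/forallP => i; have := g i; rewrite mnmDE addn_eq0;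
    by case: (bad i) => //= /andP[].
have := gu i; have := gv i; rewrite mnmDE addn_eq0.
by case: (bad i) => [/= /eqP -> /eqP ->|].
Qed.

Lemma good1 i : good U_(i) = ~~ bad i.
Proof.
apply/forallP/idP => [/(_ i)|bi j]; first by rewrite mnm1E eqxx implybF.
apply/implyP => bj; rewrite mnm1E; have [ij|//] := eqVneq i j.
by rewrite ij bj in bi.
Qed.

Hypothesis ab_disj : forall i j, a i != b j.
Hypothesis ab_inj :
  forall i j, ~~ bad i -> ~~ bad j -> a i = a j -> b i = b j -> i = j.

Lemma mnm_gt0_split (u : 'X_{1..N}) i :
  (0 < u i)%N -> exists v, u = (U_(i) + v)%MM.
Proof.
move=> ui; exists (u - U_(i))%MM; rewrite addmC submK //.
by apply/mnm_lepP => j; rewrite mnm1E; case: eqP => // <-.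
Qed.

Lemma margin_gt0 u y : (0 < margin u y)%N ->
  exists2 k, (0 < u k)%N & (y == a k) || (y == b k).
Proof.
rewrite mnm_sumE lt0n sum_nat_eq0 => /forallPn[k] /=.
rewrite -lt0n mulmnE mnmDE !mnm1E muln_gt0 addn_gt0 !lt0b.
case/andP => yk uk; exists k => //.
by rewrite !(eq_sym y).
Qed.

Lemma margin_gt0a u i : (0 < margin u (a i))%N ->
  exists2 k, (0 < u k)%N & a k = a i.
Proof.
case/margin_gt0 => k uk; rewrite (negPf (ab_disj i k)) orbF => /eqP.
by exists k.
Qed.

Lemma margin_gt0b u i : (0 < margin u (b i))%N ->
  exists2 k, (0 < u k)%N & b k = b i.
Proof.
case/margin_gt0 => k uk; rewrite eq_sym (negPf (ab_disj k i)) => /eqP.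
by exists k.
Qed.

Variable I : {pred {mpoly K[N]}}.
Hypothesis I_ideal : is_ideal I.
Hypothesis I_bad : forall i, bad i -> 'X_i \in I.
(** The 2 x 2 exchange: [k] shares its row parameter with [i], [l] shares its column parameter with
    [i], and [q] is the corner opposite to [i]. *)
Hypothesis I_move : forall i k l, ~~ bad i -> ~~ bad k -> ~~ bad l ->
  a k = a i -> b l = b i -> exists q,
  [/\ ~~ bad q, a q = a l, b q = b k & 'X_k * 'X_l - 'X_i * 'X_q \in I].

(* A variable [x_i] of [u] can be created in [v] by a single move, because [v]
   has variables [x_k], [x_l] with [a k = a i], [b l = b i]; cancel it. *)
Lemma margin_congr u v : good u -> good v -> margin u = margin v ->
  'X_[u] - 'X_[v] \in I.
Proof.
have [d] := ubnP (mdeg u); elim: d u v => // d IHd u v ud gu gv uv.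
have [u0|] := eqVneq (mdeg u) 0%N.
  move/eqP: u0; rewrite mdeg_eq0 => /eqP u0; subst u.
  suff -> : v = 0%MM by rewrite subrr; case: I_ideal.
  apply/mnmP => i; rewrite mnm0E; apply/eqP; rewrite -leqn0 leqNgt.
  apply/negP => /mnm_gt0_split[w vw]; move/mnmP/(_ (a i)): uv.
  by rewrite margin0 vw marginD margin1 !mnmDE !mnm1E eqxx mnm0E.
rewrite mdegE sum_nat_eq0 => /forallPn[i] /=.
rewrite -lt0n => /mnm_gt0_split[u' Eu].
subst u; move: gu; rewrite goodD good1 => /andP[bi gu'].
(* If both monomials contain x_i, divide by it and use the induction on the degree. *)
have IH w : good w -> margin u' = margin w ->
    'X_[U_(i) + u'] - 'X_[U_(i) + w] \in I.
  move=> gw uw; rewrite !mpolyXD -mulrBr is_idealM // IHd //.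
  by move: ud; rewrite mdegD mdeg1.
have uvE y : margin (U_(i) + u') y = margin v y by rewrite uv.
have [k vk aki] : exists2 k, (0 < v k)%N & a k = a i.
  by apply: margin_gt0a; rewrite -uvE marginD margin1 !mnmDE mnm1E eqxx.
have [l vl bli] : exists2 l, (0 < v l)%N & b l = b i.
  apply: margin_gt0b; rewrite -uvE marginD margin1 !mnmDE !mnm1E eqxx.
  by rewrite addn1.
have good_gt0 j : (0 < v j)%N -> ~~ bad j.
  move=> vj; apply/negP => bj; move: vj; move/forallP/(_ j): gv.
  by rewrite bj => /eqP ->.
have [bk bl] := (good_gt0 _ vk, good_gt0 _ vl).
case/mnm_gt0_split: vk => v1 Ev; subst v.
have addmI (w x y : 'X_{1..M}) : (w + x = w + y)%MM -> x = y.
  by move=> /mnmP E; apply/mnmP => j; have := E j; rewrite !mnmDE => /addnI.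
have [Eki|ki] := eqVneq k i.
  subst k; apply: IH; first by move: gv; rewrite goodD => /andP[].
  by apply: (addmI (margin U_(i))); rewrite -!marginD.
(* For k = l this single variable has both parameters of x_i, hence equals x_i, a case already
   settled. *)
have [Ekl|kl] := eqVneq k l.
  by case/eqP: ki; apply: ab_inj => //; rewrite Ekl.
move: vl; rewrite mnmDE mnm1E (negPf kl) => /mnm_gt0_split[v2 Ev]; subst v1.
have [q [bq aq bqk qI]] := I_move bi bk bl aki bli.
move: gv; rewrite !goodD !good1 => /and3P[_ _ g2].
(* Exchange x_k x_l for x_i x_q in v; the new monomial shares x_i with u. *)
have -> : 'X_[U_(i) + u'] - 'X_[U_(k) + (U_(l) + v2)] =
    ('X_[U_(i) + u'] - 'X_[U_(i) + (U_(q) + v2)]) -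
    'X_[v2] * ('X_k * 'X_l - 'X_i * 'X_q) :> {mpoly K[N]}.
  by rewrite !mpolyXD; ring.
apply: is_idealB => //; last exact: is_idealM.
apply: IH; first by rewrite goodD good1 bq.
apply: (addmI (margin U_(i))); rewrite -!marginD uv !marginD !margin1.
rewrite aki bli aq bqk; apply/mnmP => y; rewrite !mnmDE.
lia.
Qed.

Lemma good_mem u : ~~ good u -> 'X_[u] \in I.
Proof.
case/forallPn => i; rewrite negb_imply -lt0n => /andP[bi].
case/mnm_gt0_split => v ->.
by rewrite mpolyXD mulrC is_idealM ?I_bad.
Qed.

(* [lift] is linear, and [lift (toric_map 'X_[u])] is [0] or a monomial with the
   same margin as [u]; either way it is congruent to ['X_[u]] modulo [I]. *)
Lemma toric_ker_sub p : toric_map p = 0 -> p \in I.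
Proof.
move=> p0; pose r := undup [seq margin u | u <- msupp p].
(* The first good monomial of p with margin w. The default 0 is reached only if there is none, and
   then w has coefficient 0 in the image of every monomial of p. *)
pose sigma (w : 'X_{1..M}) : 'X_{1..N} :=
  nth 0%MM (msupp p) (find (fun u => good u && (margin u == w)) (msupp p)).
pose lift (x : {mpoly K[M]}) : {mpoly K[N]} :=
  \sum_(w <- r) x@_w *: 'X_[sigma w].
have liftZ c x : lift (c *: x) = c *: lift x.
  by rewrite scaler_sumr; apply: eq_bigr => w _; rewrite mcoeffZ scalerA.
have lift0 : lift 0 = 0.
  by rewrite /lift big1 // => w _; rewrite mcoeff0 scale0r.
have lift_sum (s : seq 'X_{1..N}) F :
    lift (\sum_(u <- s) F u) = \sum_(u <- s) lift (F u).
  apply: (big_morph lift) => // x y; rewrite -big_split; apply: eq_bigr.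
  by move=> w _; rewrite mcoeffD scalerDl.
have liftX w : w \in r -> lift 'X_[w] = 'X_[sigma w].
  move=> wr; rewrite /lift (bigD1_seq w) ?undup_uniq //= mcoeffX eqxx scale1r.
  by rewrite big1 ?addr0 // => x xw; rewrite mcoeffX eq_sym (negPf xw) scale0r.
have -> : p = p - lift (toric_map p) by rewrite p0 lift0 subr0.
have -> : toric_map p = \sum_(u <- msupp p) p@_u *: toric_map 'X_[u].
  by rewrite {1}[p]mpolyE rmorph_sum; apply: eq_bigr => u _; apply: toric_mapZ.
rewrite {1}[p]mpolyE lift_sum -sumrB.
apply: is_ideal_sum => // u us.
rewrite liftZ -scalerBr -mul_mpolyC is_idealM //.
rewrite toric_mapX; case: ifP => [gu|/negbT gu]; last first.
  by rewrite lift0 subr0 good_mem.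
have ur : margin u \in r by rewrite mem_undup map_f.
have /andP[gs /eqP ms] : good (sigma (margin u)) &&
    (margin (sigma (margin u)) == margin u).
  apply: (@nth_find _ _ (fun v => good v && (margin v == margin u))).
  by apply/hasP; exists u; rewrite ?gu ?eqxx.
by rewrite liftX // margin_congr.
Qed.

End ToricKernel.

(** * Edges of a graph and induction along paths *)

Section Edges.

Variables (T : finType) (G : sgraph T).

Lemma edge_endpoint e i : e \in edges G -> i \in e ->
  exists2 a, G i a & e = [set i; a].
Proof.
case/imsetP => -[u v] /=; rewrite inE /= => Guv ->.
rewrite !inE => /orP[] /eqP ->; first by exists v.
by exists u; rewrite 1?adj_sym // setUC.
Qed.

Lemma mem_edges i j : ([set i; j] \in edges G) = G i j.
Proof.
apply/idP/idP => [ij|Gij]; last by apply/imsetP; exists (i, j); rewrite ?inE.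
have [a Gia Ea] := edge_endpoint ij (set21 i j).
have : a \in [set i; j] by rewrite Ea set22.
rewrite !inE => /orP[] /eqP Eai; last by rewrite -Eai.
by move: Gia; rewrite Eai adj_irrefl.
Qed.

End Edges.

Lemma connect_ind_r (T : finType) (e : rel T) x (P : T -> Prop) : P x ->
  (forall y z, connect e x y -> e y z -> P y -> P z) ->
  forall y, connect e x y -> P y.
Proof.
move=> Px Pstep y /connectP[p]; elim/last_ind: p y => [|p z IHp] y /=.
  by move=> _ ->.
rewrite rcons_path last_rcons => /andP[xp pz] ->.
apply: Pstep pz (IHp _ xp erefl).
by apply/connectP; exists p.
Qed.

(** * Blocks of cells and the components of W^c *)

Section Grid.

Variables (m n : nat) (G1 : sgraph 'I_m) (G2 : sgraph 'I_n).
Variable W : {set 'I_m * 'I_n}.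

(** The box {i,a} x {j,b} lies in W^c. Naming its corners in order singles out (i, j) as the cell
    from which [hrel] steps along the row and [vrel] along the column. *)
Definition free_box i a j b :=
  [&& G1 i a, G2 j b, (i, j) \notin W, (i, b) \notin W &
      ((a, j) \notin W) && ((a, b) \notin W)].

Definition hrel i : rel 'I_n := fun j b => [exists a, free_box i a j b].
Definition vrel j : rel 'I_m := fun i a => [exists b, free_box i a j b].

(* For admissible [W]: [p = q], or [p] and [q] lie in boxes of one component
   of [W^c]. *)
Definition same_block (p q : 'I_m * 'I_n) :=
  connect (hrel p.1) p.2 q.2 && connect (vrel p.2) p.1 q.1.

Lemma free_boxCl i a j b : free_box i a j b = free_box a i j b.
Proof.
by apply/and5P/and5P => -[? ? ? ? /andP[? ?]];
  rewrite adj_sym; split => //; apply/andP.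
Qed.

Lemma free_boxCr i a j b : free_box i a j b = free_box i a b j.
Proof.
by apply/and5P/and5P => -[? ? ? ? /andP[? ?]];
  rewrite (adj_sym G2); split => //; apply/andP.
Qed.

Lemma hrel_sym i : connect_sym (hrel i).
Proof.
apply: sym_connect_sym => j b.
by apply: eq_existsb => a; rewrite free_boxCr.
Qed.

Lemma vrel_sym j : connect_sym (vrel j).
Proof.
apply: sym_connect_sym => i a.
by apply: eq_existsb => b; rewrite free_boxCl.
Qed.

Lemma same_block_refl : reflexive same_block.
Proof. by move=> p; rewrite /same_block !connect0. Qed.

Hypothesis W_adm : admissible G1 G2 W.

(** If (a, b) were in W, admissibility would put one of its two neighbours (a, j), (i, b) in W. *)
Lemma admissible_corner i a j b : G1 i a -> G2 j b ->
  (a, j) \notin W -> (i, b) \notin W -> (a, b) \notin W.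
Proof.
move=> ia jb ajW ibW; apply/negP => abW.
have [] := W_adm (e := [set i; a]) (f := [set j; b]) _ _ (i := a) (j := b).
- by rewrite mem_edges.
- by rewrite mem_edges.
- by rewrite inE abW !inE !eqxx !orbT.
- move/subsetP/(_ (a, j)); rewrite !inE !eqxx (negPf ajW) => H.
  by have := H isT.
move/subsetP/(_ (i, b)); rewrite !inE !eqxx (negPf ibW) => H.
by have := H isT.
Qed.

(** The two steps may come from different boxes, but together they free three corners of this one,
    and admissibility frees the fourth. *)
Lemma hrel_vrel_box i a j b : hrel i j b -> vrel j i a -> free_box i a j b.
Proof.
case/existsP => x /and5P[_ jb ijW ibW _].
case/existsP => y /and5P[ia _ _ _ /andP[ajW _]].
by apply/and5P; split; rewrite // ajW (admissible_corner ia jb).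
Qed.

(** A horizontal step slides along a vertical path: with each vertical step it spans a free box,
    whose opposite sides give the shifted steps. *)
Lemma hrel_shift i a j b : hrel i j b -> connect (vrel j) i a ->
  hrel a j b /\ connect (vrel b) i a.
Proof.
move=> ijb; move: a.
apply: connect_ind_r => [//|y z _ yz [yjb iy]].
have box := hrel_vrel_box yjb yz; split.
  by apply/existsP; exists y; rewrite free_boxCl.
apply: connect_trans iy (connect1 _).
by apply/existsP; exists j; rewrite free_boxCr.
Qed.

(** Parallel transport of whole paths, obtained by sliding one horizontal step after the other. This
    is what makes blocks rectangles. *)
Lemma connect_grid i a j b :
  connect (hrel i) j b -> connect (vrel j) i a ->
  connect (hrel a) j b /\ connect (vrel b) i a.
Proof.
move=> ijb ia; move: b ijb.
apply: connect_ind_r => [//|y z _ yz [ajy iya]].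
have [ayz ?] := hrel_shift yz iya; split => //.
exact: connect_trans ajy (connect1 ayz).
Qed.

Lemma same_block_sym : ssrbool.symmetric same_block.
Proof.
suff sub p q : same_block p q -> same_block q p.
  by move=> p q; apply/idP/idP; apply: sub.
case: p q => i j [k l] /andP[/= jl ik]; have [jl' ik'] := connect_grid jl ik.
by apply/andP; split; rewrite /= 1?hrel_sym 1?vrel_sym.
Qed.

Lemma same_block_trans : transitive same_block.
Proof.
move=> [k l] [i j] [x y] /andP[/= jl ik] /andP[/= ly kx].
have [jl' ik'] := connect_grid jl ik.
(* Transport the paths that leave (k, l) back to row i and to column j, where they continue the
   first two. *)
have [iy _] : connect (hrel i) l y /\ connect (vrel y) k i.
  by apply: connect_grid ly _; rewrite vrel_sym.
have [_ jkx] : connect (hrel x) l j /\ connect (vrel j) k x.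
  by apply: connect_grid _ kx; rewrite 1?hrel_sym.
by apply/andP; split; [apply: connect_trans iy | apply: connect_trans jkx].
Qed.

Lemma same_block_row i j k l : same_block (i, j) (k, l) ->
  same_block (i, j) (i, l).
Proof. by case/andP => /= jl _; rewrite /same_block /= jl connect0. Qed.

Lemma same_block_col i j k l : same_block (i, j) (k, l) ->
  same_block (i, j) (k, j).
Proof. by case/andP => /= _ ik; rewrite /same_block /= ik connect0. Qed.

Lemma same_block_notin p q : same_block p q -> p \notin W -> q \notin W.
Proof.
case: p q => i j [k l] /andP[/= jl ik] ijW.
have [_ {ik}] := connect_grid jl ik.
have ilW : (i, l) \notin W.
  by move: l jl; apply: connect_ind_r => // y z _ /existsP[? /and5P[]].
move: k; apply: connect_ind_r => // y z _.
by case/existsP => ? /and5P[_ _ _ _ /andP[]].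
Qed.

Definition block p := [set q | same_block p q].

Lemma block_eqP p q : reflect (block p = block q) (same_block p q).
Proof.
apply: (iffP idP) => [pq|pq]; last first.
  have : q \in block p by rewrite pq inE same_block_refl.
  by rewrite inE.
apply/setP => x; rewrite !inE; apply/idP/idP; apply: same_block_trans => //.
by rewrite same_block_sym.
Qed.

Lemma Wcompl_box c i j : c \in Wcompl G1 G2 W -> i \in c.1 -> j \in c.2 ->
  exists a b, c = ([set i; a], [set j; b]) /\ free_box i a j b.
Proof.
case: c => e f; rewrite !inE /= => /andP[/andP[eE fE] /eqP W0] ie jf.
have [a ia Ee] := edge_endpoint eE ie; have [b jb Ef] := edge_endpoint fE jf.
exists a, b; rewrite -Ee -Ef; split => //.
have notW x y : x \in e -> y \in f -> (x, y) \notin W.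
  move=> xe yf; apply/negP => xyW.
  have : (x, y) \in W :&: setX e f by rewrite !inE /= xyW xe yf.
  by rewrite W0 inE.
by rewrite /free_box ia jb !notW // ?Ee ?Ef ?set21 ?set22.
Qed.

Lemma free_box_Wcompl i a j b :
  free_box i a j b -> ([set i; a], [set j; b]) \in Wcompl G1 G2 W.
Proof.
case/and5P => ia jb ijW ibW /andP[ajW abW]; rewrite !inE /= !mem_edges ia jb /=.
apply/eqP/setP => -[x y]; rewrite !inE /=; apply/negbTE.
apply/negP => /and3P[xyW /orP[]/eqP Ex /orP[]/eqP Ey];
  by move: xyW; rewrite Ex Ey; apply/negP.
Qed.

Lemma Wcompl_same_block c p q : c \in Wcompl G1 G2 W ->
  p \in setX c.1 c.2 -> q \in setX c.1 c.2 -> same_block p q.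
Proof.
case: p q => i j [k l] cE; rewrite !inE /= => /andP[ic jc] /andP[kc lc].
have [a [b [Ec box]]] := Wcompl_box cE ic jc.
move: kc lc; rewrite Ec !inE /same_block /= => ka lb; apply/andP; split.
  case/orP: lb => /eqP ->; first exact: connect0.
  by apply/connect1/existsP; exists a.
case/orP: ka => /eqP ->; first exact: connect0.
by apply/connect1/existsP; exists b.
Qed.

(** Consecutive boxes of the chain share a cell, and each box lies in a single block. *)
Lemma meets_same_block c d p q : c \in Wcompl G1 G2 W ->
  connect (meets_in (Wcompl G1 G2 W)) c d ->
  p \in setX c.1 c.2 -> q \in setX d.1 d.2 -> same_block p q.
Proof.
move=> cE cd pc; move: d cd q.
apply: connect_ind_r => [q|d d' _]; first exact: Wcompl_same_block.
case/and3P => dE d'E /set0Pn[r]; rewrite inE => /andP[rd rd'] IHd q qd'.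
exact: same_block_trans (IHd _ rd) (Wcompl_same_block d'E rd' qd').
Qed.

(** A component covers the rows and columns of exactly one block, and the block is their full
    product. This replaces the completion by an equivalence of cells. *)
Lemma mem_Wcompl_hat i j k l : i != j -> k != l ->
  (([set i; j], [set k; l]) \in Wcompl_hat G1 G2 W) =
  same_block (i, k) (j, l).
Proof.
move=> ij kl; apply/bigcupP/idP => [[C /imsetP[c0 c0E ->]]|].
  rewrite !inE /= !subUset !sub1set => /andP[/andP[/andP[iC jC] _]].
  move/andP => [/andP[kC lC] _].
  set C0 := [set _ in _ | _] in iC jC kC lC.
  have inC0 c : c \in C0 -> exists i0 j0, [/\ i0 \in c.1, j0 \in c.2
      & forall p q, p \in setX c0.1 c0.2 -> q \in setX c.1 c.2 ->
        same_block p q].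
    rewrite inE => /andP[cE c0c].
    move: (cE); rewrite !inE => /andP[/andP[]].
    case/imsetP => -[i1 i2] _ Ec1 /imsetP[[j1 j2] _ Ec2] _.
    exists i1, j1; rewrite Ec1 Ec2 !set21; split=> // p q pc0 qc.
    by apply: meets_same_block c0E c0c pc0 _; rewrite Ec1 Ec2 in qc *.
  have [|i0 [j0 [i0c j0c _]]] := inC0 c0; first by rewrite inE c0E connect0.
  have p0 : (i0, j0) \in setX c0.1 c0.2 by rewrite inE i0c.
  have rowC x : x \in cover [set c.1 | c in C0] ->
      exists y, same_block (i0, j0) (x, y).
    case/bigcupP => e /imsetP[c cC ->] xc.
    have [_ [y [_ yc cP]]] := inC0 c cC.
    by exists y; apply: cP => //; rewrite inE xc.
  have colC y : y \in cover [set c.2 | c in C0] ->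
      exists x, same_block (i0, j0) (x, y).
    case/bigcupP => e /imsetP[c cC ->] yc.
    have [x [_ [xc _ cP]]] := inC0 c cC.
    by exists x; apply: cP => //; rewrite inE xc.
  (* Row x and column y each meet the block in some cell; rectangularity puts their crossing (x, y)
     in it. *)
  have cellC x y : x \in cover [set c.1 | c in C0] ->
      y \in cover [set c.2 | c in C0] -> same_block (i0, j0) (x, y).
    case/rowC => y' xy' /colC[x' x'y].
    apply: (same_block_trans (xy')); apply: (@same_block_row _ _ x' _).
    by apply: same_block_trans x'y; rewrite same_block_sym.
  by apply: same_block_trans (cellC _ _ jC lC); rewrite same_block_sym cellC.
case/andP => /= hkl vij.
(* As i differs from j, the vertical path has a first step, and its box is the base point of the
   component sought. *)
have /existsP[a /existsP[b box]] : [exists a, exists b, free_box i a k b].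
  case/connectP: (vij) => -[|a p] /= => [_ ji|/andP[ia _] _].
    by case/eqP: ij.
  by apply/existsP; exists a.
pose c0 := ([set i; a], [set k; b]).
have c0E : c0 \in Wcompl G1 G2 W := free_box_Wcompl box.
pose reach x y := exists2 d, d \in Wcompl G1 G2 W &
  connect (meets_in (Wcompl G1 G2 W)) c0 d /\ (x, y) \in setX d.1 d.2.
have reachS x y d' : reach x y -> d' \in Wcompl G1 G2 W ->
    (x, y) \in setX d'.1 d'.2 -> connect (meets_in (Wcompl G1 G2 W)) c0 d'.
  case=> d dE [c0d xyd] d'E xyd'.
  apply: connect_trans c0d (connect1 _); apply/and3P; split=> //.
  by apply/set0Pn; exists (x, y); rewrite inE xyd.
have reach_ik : reach i k by exists c0; rewrite // connect0 inE /= !set21.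
have reach_jk : reach j k.
  move: j vij {ij hkl}; apply: connect_ind_r => // x y _ /existsP[b' xy] xk.
  have dE := free_box_Wcompl xy; exists ([set x; y], [set k; b']) => //.
  split; last by rewrite inE /= ?set21 ?set22.
  by apply: (reachS x k) => //; rewrite inE /= !set21.
have reach_jl : reach j l.
  (* Continue from (j, k) to (j, l) along the horizontal path transported to row j; successive boxes
     still meet. *)
  have [hjkl _] := connect_grid hkl vij.
  move: l hjkl {kl hkl}; apply: connect_ind_r => // x y _ /existsP[a' xy] jx.
  have dE := free_box_Wcompl xy; exists ([set j; a'], [set x; y]) => //.
  split; last by rewrite inE /= ?set21 ?set22.
  by apply: (reachS j x) => //; rewrite inE /= !set21.
exists [set d in Wcompl G1 G2 W | connect (meets_in (Wcompl G1 G2 W)) c0 d].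
  by apply/imsetP; exists c0.
have reach_cover x y : reach x y -> x \in cover [set c.1 | c in
    [set d in Wcompl G1 G2 W | connect (meets_in (Wcompl G1 G2 W)) c0 d]] /\
    y \in cover [set c.2 | c in
    [set d in Wcompl G1 G2 W | connect (meets_in (Wcompl G1 G2 W)) c0 d]].
  case=> d dE [c0d]; rewrite inE => /andP[xd yd]; split; apply/bigcupP.
    by exists d.1 => //; apply: imset_f; rewrite inE dE.
  by exists d.2 => //; apply: imset_f; rewrite inE dE.
have [iC kC] := reach_cover _ _ reach_ik.
have [jC lC] := reach_cover _ _ reach_jl.
by rewrite !inE /= !subUset !sub1set iC kC jC lC !cards2 ij kl.
Qed.

End Grid.

Lemma mpolyX_neq0 (K : fieldType) N (u : 'X_{1..N}) :
  ('X_[u] : {mpoly K[N]}) != 0%R.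
Proof. by rewrite -msupp_eq0 msuppX. Qed.

Lemma mpolyX_inj (K : fieldType) N :
  injective (fun u : 'X_{1..N} => 'X_[u] : {mpoly K[N]}).
Proof. by move=> u v /(congr1 (@msupp _ _)); rewrite !msuppX => -[]. Qed.

(** * Minors, binomial ideals and the ideals P_W *)

Section BinomialIdeals.

Import GRing.Theory.
Local Open Scope ring_scope.

Variables (K : fieldType) (m n : nat).
Implicit Types (S P Q : {pred {mpoly K[m * n]}}) (W : {set 'I_m * 'I_n}).

Local Notation x := (Defs.genmx K m n).
Local Notation p_ := (minor2 x).

Lemma minor2_swap_rows i j k l : p_ j i k l = - p_ i j k l.
Proof. by rewrite /minor2; ring. Qed.

Lemma minor2_swap_cols i j k l : p_ i j l k = - p_ i j k l.
Proof. by rewrite /minor2; ring. Qed.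

(** The generators have increasing indices; swapping two rows or columns changes only the sign, and
    a repeated index gives 0. *)
Lemma mem_binomial_ideal (E : {set {set 'I_m} * {set 'I_n}}) i j k l :
  ([set i; j], [set k; l]) \in E -> p_ i j k l \in binomial_ideal K E.
Proof.
have I_ideal := ideal_gen_is_ideal (fun p => exists (i j : 'I_m) (k l : 'I_n),
    [/\ (i < j)%N, (k < l)%N, ([set i; j], [set k; l]) \in E
      & p = p_ i j k l]).
wlog ij : i j / (i < j)%N => [IH ijE|].
  case: (ltngtP i j) => [|ji|/val_inj ij]; first by move/IH; apply.
    by rewrite minor2_swap_rows is_idealN // IH // setUC.
  suff -> : p_ i j k l = 0 by case: I_ideal.
  by rewrite ij /minor2; ring.
wlog kl : k l / (k < l)%N => [IH klE|].
  case: (ltngtP k l) => [|lk|/val_inj kl]; first by move/IH; apply.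
    by rewrite minor2_swap_cols is_idealN // IH // [X in (_, X)]setUC.
  suff -> : p_ i j k l = 0 by case: I_ideal.
  by rewrite kl /minor2; ring.
by move=> ijklE; apply: mem_ideal_gen; exists i, j, k, l.
Qed.

Lemma binomial_ideal_sub (E : {set {set 'I_m} * {set 'I_n}}) S :
  is_ideal S ->
  (forall i j k l, i != j -> k != l -> ([set i; j], [set k; l]) \in E ->
    p_ i j k l \in S) ->
  {subset binomial_ideal K E <= S}.
Proof.
move=> S_ideal ES; apply: ideal_gen_sub => // p.
case=> [i [j [k [l [ij kl ijklE ->]]]]].
by apply: ES => //; [move: ij | move: kl]; rewrite ltn_neqAle => /andP[].
Qed.

Variables (G1 : sgraph 'I_m) (G2 : sgraph 'I_n).

Lemma PW_is_ideal W : is_ideal (PW K G1 G2 W).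
Proof. by apply: ideal_add_is_ideal; apply: ideal_gen_is_ideal. Qed.

Lemma PW_var W i j : (i, j) \in W -> x i j \in PW K G1 G2 W.
Proof.
move=> ijW; apply: sub_ideal_addl; first exact: ideal_gen_is_ideal.
by apply: mem_ideal_gen; exists i, j.
Qed.

Lemma PW_minor2 W i j k l : ([set i; j], [set k; l]) \in Wcompl_hat G1 G2 W ->
  p_ i j k l \in PW K G1 G2 W.
Proof.
move=> ijkl; apply: sub_ideal_addr; first exact: ideal_gen_is_ideal.
exact: mem_binomial_ideal.
Qed.

Lemma PW_sub W S : is_ideal S ->
  (forall i j, (i, j) \in W -> x i j \in S) ->
  (forall i j k l, i != j -> k != l ->
    ([set i; j], [set k; l]) \in Wcompl_hat G1 G2 W -> p_ i j k l \in S) ->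
  {subset PW K G1 G2 W <= S}.
Proof.
move=> S_ideal WS hatS; apply: ideal_add_sub => //; last first.
  exact: binomial_ideal_sub.
by apply: ideal_gen_sub => // p [i [j [ijW ->]]]; apply: WS.
Qed.

(** Every edge of the box contains one cell of each diagonal, so both terms of the minor lie in
    P_W. *)
Lemma PW_box_edge W i j k l g :
  g \in box_edges [set i; j] [set k; l] -> g \subset W ->
  p_ i j k l \in PW K G1 G2 W.
Proof.
have PWi := PW_is_ideal W; rewrite inE => gE gW.
have inW s t : (s, t) \in g -> x s t \in PW K G1 G2 W.
  by move=> stg; apply/PW_var/(subsetP gW).
have aux : (x i k \in PW K G1 G2 W) || (x j l \in PW K G1 G2 W) ->
    (x i l \in PW K G1 G2 W) || (x j k \in PW K G1 G2 W) ->
    p_ i j k l \in PW K G1 G2 W.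
  move=> ikjl iljk; apply: is_idealB => //.
    by case/orP: ikjl => ?; [rewrite mulrC|]; apply: is_idealM.
  by case/orP: iljk => ?; [rewrite mulrC|]; apply: is_idealM.
by case/orP: gE => /imsetP[s]; rewrite !inE => /orP[]/eqP -> Eg;
  apply: aux; apply/orP;
  (by left; apply: inW; rewrite Eg !inE /= !eqxx ?orbT) ||
  (by right; apply: inW; rewrite Eg !inE /= !eqxx ?orbT).
Qed.

(** * P_W as the kernel of a monomial map *)

Section ToricParametrization.

Variable W : {set 'I_m * 'I_n}.
Hypothesis W_adm : admissible G1 G2 W.

Definition cell (v : 'I_(m * n)) : 'I_m * 'I_n :=
  enum_val (cast_ord (esym (mxvec_cast m n)) v).

Lemma cell_mxvec_index i j : cell (mxvec_index i j) = (i, j).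
Proof. by rewrite /cell cast_ordK enum_rankK. Qed.

Local Notation blk := (block G1 G2 W).
(** Row parameters on the left, column parameters on the right. A component is named by its block as
    a set of cells, which also covers singleton blocks; pairs with a set that is no block are
    harmless extra variables. *)
Local Notation params :=
  (('I_m * {set 'I_m * 'I_n}) + ('I_n * {set 'I_m * 'I_n}))%type.

Definition in_W v := cell v \in W.

Definition row_param v : 'I_#|{: params}| :=
  enum_rank (inl ((cell v).1, blk (cell v)) : params).

Definition col_param v : 'I_#|{: params}| :=
  enum_rank (inr ((cell v).2, blk (cell v)) : params).

Local Notation phi := (toric_map K in_W row_param col_param).
Local Notation a i j := (row_param (mxvec_index i j)).
Local Notation b i j := (col_param (mxvec_index i j)).

Lemma row_col_paramF v w : row_param v != col_param w.
Proof. by rewrite /row_param /col_param (inj_eq enum_rank_inj). Qed.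

Lemma row_param_eqP i j k l :
  reflect (i = k /\ blk (i, j) = blk (k, l)) (a i j == a k l).
Proof.
rewrite (inj_eq enum_rank_inj) !cell_mxvec_index.
by apply: (iffP eqP) => [[-> ->]|[-> ->]].
Qed.

Lemma col_param_eqP i j k l :
  reflect (j = l /\ blk (i, j) = blk (k, l)) (b i j == b k l).
Proof.
rewrite (inj_eq enum_rank_inj) !cell_mxvec_index.
by apply: (iffP eqP) => [[-> ->]|[-> ->]].
Qed.

Lemma phi_var i j : phi (x i j) =
  if (i, j) \in W then 0 else 'X_[U_(a i j) + U_(b i j)].
Proof. by rewrite mxE toric_map_var /in_W cell_mxvec_index. Qed.

Lemma block_rect i j k l : blk (i, j) = blk (k, l) ->
  blk (i, l) = blk (i, j) /\ blk (k, j) = blk (i, j).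
Proof.
move/(block_eqP W_adm) => ijkl; split; apply/esym/(block_eqP W_adm).
  exact: same_block_row ijkl.
exact: same_block_col ijkl.
Qed.

Lemma block_in_W p q : blk p = blk q -> (p \in W) = (q \in W).
Proof.
suff sub p' q' : blk p' = blk q' -> p' \notin W -> q' \notin W.
  by move=> pq; apply: negb_inj; apply/idP/idP; apply: sub.
by move/(block_eqP W_adm); apply: same_block_notin.
Qed.

(** Kernel elements are reduced by exchanges inside a block, each a minor of P_W up to sign;
    conversely the map kills the generators. *)
Lemma mem_PW p : (p \in PW K G1 G2 W) = (phi p == 0).
Proof.
apply/idP/eqP => [pW|]; last first.
  apply: toric_ker_sub.
  - exact: row_col_paramF.
  - move=> v w _ _; case/mxvec_indexP: v => i j; case/mxvec_indexP: w => k l.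
    by move=> /eqP/row_param_eqP[-> _] /eqP/col_param_eqP[-> _].
  - exact: PW_is_ideal.
  - move=> v; case/mxvec_indexP: v => i j; rewrite /in_W cell_mxvec_index.
    by move/PW_var; rewrite mxE.
  move=> u v w; case/mxvec_indexP: u => i j; case/mxvec_indexP: v => i' k.
  case/mxvec_indexP: w => l j'; rewrite /in_W !cell_mxvec_index => ijW _ _.
  move=> /eqP/row_param_eqP[-> ik] /eqP/col_param_eqP[-> lj] {i' j'}.
  have [lk _] := block_rect (etrans lj (esym ik)).
  (* The fourth corner of the rectangle on (i, j), (i, k), (l, j), which lies in their common
     block. *)
  exists (mxvec_index l k); rewrite cell_mxvec_index; split.
  - by rewrite (block_in_W lk) (block_in_W lj).
  - by apply/eqP/row_param_eqP.
  - by apply/eqP/col_param_eqP; rewrite lk lj ik.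
  have [il|il] := eqVneq i l.
    by rewrite il mulrC subrr; case: (PW_is_ideal W).
  have [jk|jk] := eqVneq j k.
    by rewrite jk subrr; case: (PW_is_ideal W).
  have -> : 'X_(mxvec_index i k) * 'X_(mxvec_index l j) -
      'X_(mxvec_index i j) * 'X_(mxvec_index l k) =
      - p_ i l j k :> {mpoly K[_]}.
    by rewrite /minor2 !mxE; ring.
  apply: is_idealN (PW_is_ideal W) _; apply: PW_minor2.
  rewrite (mem_Wcompl_hat W_adm) //; apply/(block_eqP W_adm).
  by rewrite lk lj.
apply/eqP; move: p pW; apply: (PW_sub (S := [pred p | phi p == 0])).
- split; first by rewrite inE rmorph0.
  move=> c u v; rewrite !inE => /eqP u0 /eqP v0.
  by rewrite rmorphD rmorphM u0 v0 mulr0 addr0.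
- by move=> i j ijW; rewrite inE phi_var ijW.
move=> i j k l ij kl; rewrite (mem_Wcompl_hat W_adm) //.
move/(block_eqP W_adm) => ikjl; have [il jk] := block_rect ikjl.
rewrite inE rmorphB !rmorphM !phi_var -(block_in_W ikjl).
rewrite (block_in_W il) (block_in_W jk); case: ifP => _.
  by rewrite !mul0r subrr.
rewrite -!mpolyXD subr_eq0; apply/eqP; congr 'X_[_].
(* All four cells share a block, so both diagonals have the same two row and two column
   parameters. *)
have -> : a i l = a i k by apply/eqP/row_param_eqP.
have -> : a j k = a j l by apply/eqP/row_param_eqP; rewrite jk.
have -> : b i l = b j l by apply/eqP/col_param_eqP; rewrite il.
have -> : b j k = b i k by apply/eqP/col_param_eqP.
by apply/mnmP => y; rewrite !mnmDE; lia.
Qed.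

(** A kernel of a ring morphism into an integral domain. *)
Lemma PW_prime : prime_ideal (PW K G1 G2 W).
Proof.
split; last by move=> u v; rewrite !mem_PW rmorphM mulf_eq0.
have [P0 P_lin] := PW_is_ideal W; split=> //.
by rewrite mem_PW rmorph1 oner_eq0.
Qed.

Lemma var_in_PW i j : (x i j \in PW K G1 G2 W) = ((i, j) \in W).
Proof.
rewrite mem_PW phi_var; case: ifP; rewrite ?eqxx //.
by rewrite (negPf (mpolyX_neq0 _ _)).
Qed.

(** The two diagonals have equal images. A cell of W on one diagonal would force a cell of W on the
    other, and the two would form an edge; so the box avoids W and the parameters can be
    compared. *)
Lemma minor2_in_PW i j k l : i != j -> k != l ->
  p_ i j k l \in PW K G1 G2 W ->
  (forall g, g \in box_edges [set i; j] [set k; l] -> ~~ (g \subset W)) ->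
  ([set i; j], [set k; l]) \in Wcompl_hat G1 G2 W.
Proof.
move=> ij kl; rewrite mem_PW rmorphB !rmorphM !phi_var subr_eq0 => /eqP pE gW.
have rowW s : s \in [set i; j] -> ~~ (((s, k) \in W) && ((s, l) \in W)).
  move=> sij; apply: contra (gW (setX [set s] [set k; l]) _).
    case/andP => skW slW; apply/subsetP => -[s' t]; rewrite !inE /=.
    by case/andP => /eqP -> /orP[]/eqP ->.
  by rewrite inE; apply/orP; left; apply/imsetP; exists s.
have colW t : t \in [set k; l] -> ~~ (((i, t) \in W) && ((j, t) \in W)).
  move=> tkl; apply: contra (gW (setX [set i; j] [set t]) _).
    case/andP => itW jtW; apply/subsetP => -[s t']; rewrite !inE /=.
    by case/andP => /orP[]/eqP -> /eqP ->.
  by rewrite inE; apply/orP; right; apply/imsetP; exists t.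
move: (rowW i) (rowW j) (colW k) (colW l) pE; rewrite !inE !eqxx !orbT.
move=> /(_ isT) + /(_ isT) + /(_ isT) + /(_ isT).
case: ((i, k) \in W); case: ((j, l) \in W); case: ((i, l) \in W);
  case: ((j, k) \in W) => //= _ _ _ _; rewrite ?mulr0 ?mul0r -?mpolyXD;
  try by (move/eqP; rewrite ?[0 == _]eq_sym (negPf (mpolyX_neq0 _ _))).
(* The column parameter of (i, k) must recur on the other diagonal, and only (j, k) is in column k;
   likewise its row parameter recurs at (i, l). *)
move/mpolyX_inj/mnmP => E.
have bF : b i l == b i k = false.
  by apply/col_param_eqP => -[lk _]; rewrite lk eqxx in kl.
have aF : a j k == a i k = false.
  by apply/row_param_eqP => -[ji _]; rewrite ji eqxx in ij.
have /col_param_eqP[_ jkik] : b j k == b i k.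
  have := E (b i k); rewrite !mnmDE !mnm1E !(negPf (row_col_paramF _ _)) bF.
  by rewrite eqxx; case: (b j k == b i k) => //; case: (_ == _).
have /row_param_eqP[_ ilik] : a i l == a i k.
  have := E (a i k); rewrite !mnmDE !mnm1E aF eqxx.
  rewrite ![col_param _ == _]eq_sym !(negPf (row_col_paramF _ _)).
  by case: (a i l == a i k) => //; case: (_ == _).
rewrite (mem_Wcompl_hat W_adm) //; apply/(block_eqP W_adm).
by have [-> _] := block_rect (etrans jkik (esym ilik)).
Qed.

End ToricParametrization.

(** A box of two edges either avoids W, so its minor is a generator, or meets W, and then
    admissibility puts one of its edges in W. *)
Lemma edge_ideal_sub_PW W : admissible G1 G2 W ->
  {subset edge_ideal K G1 G2 <= PW K G1 G2 W}.
Proof.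
move=> W_adm; apply: binomial_ideal_sub (PW_is_ideal W) _ => i j k l ij kl.
rewrite inE /= !mem_edges => /andP[Gij Gkl].
have [box|] := boolP (free_box G1 G2 W i j k l).
  apply: PW_minor2; rewrite (mem_Wcompl_hat W_adm) //.
  apply: (Wcompl_same_block (free_box_Wcompl box));
    by rewrite inE /= ?set21 ?set22.
rewrite /free_box Gij Gkl /= => nbox.
have [u [v [uij vkl uvW]]] : exists u v,
    [/\ u \in [set i; j], v \in [set k; l] & (u, v) \in W].
  move: nbox; rewrite !negb_and !negbK.
  by case/or4P => [H|H|H|H]; [exists i, k | exists i, l | exists j, k
    | exists j, l]; rewrite ?set21 ?set22.
have uvb : (u, v) \in setX [set i; j] [set k; l] :&: W.
  by rewrite !inE uvW andbT /= -!in_set2 uij vkl.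
have [||gW|gW] := W_adm [set i; j] [set k; l] _ _ u v uvb;
  rewrite ?mem_edges //; apply: PW_box_edge gW; rewrite inE; apply/orP.
  by left; apply/imsetP; exists u.
by right; apply/imsetP; exists v.
Qed.

(** * Primes containing the edge ideal *)

Section PrimesOverEdgeIdeal.

Variable P : {pred {mpoly K[m * n]}}.
Hypothesis P_prime : prime_ideal P.
Hypothesis JP : {subset edge_ideal K G1 G2 <= P}.

Definition vars_in : {set 'I_m * 'I_n} := [set u | x u.1 u.2 \in P].

Lemma edge_minor2_in i j k l : G1 i j -> G2 k l -> p_ i j k l \in P.
Proof.
move=> Gij Gkl; apply/JP/mem_binomial_ideal.
by rewrite inE /= !mem_edges Gij.
Qed.

Lemma P_is_ideal : is_ideal P.
Proof. by case: P_prime => /idealr_is_ideal. Qed.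

Lemma P_cancel p q : p \notin P -> p * q \in P -> q \in P.
Proof. by case: P_prime => _ Pp pP /Pp; rewrite (negPf pP). Qed.

(** If x_ij is in P, the minor of a box at (i, j) puts the product of the other diagonal in P;
    primality picks a factor, which completes an edge. *)
Lemma vars_in_admissible : admissible G1 G2 vars_in.
Proof.
move=> e f eE fE i j; rewrite !inE /= => /andP[/andP[ie jf] ijP].
have [a Gia ->] := edge_endpoint eE ie.
have [b Gjb ->] := edge_endpoint fE jf.
have : x i b * x a j \in P.
  have -> : x i b * x a j = x a b * x i j - p_ i a j b.
    by rewrite /minor2; ring.
  apply: is_idealB P_is_ideal _ (edge_minor2_in Gia Gjb).
  exact: is_idealM P_is_ideal ijP.
case: P_prime => _ Pp /Pp /orP[ibP|ajP]; [left|right]; apply/subsetP => -[s t].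
  by rewrite !inE /= => /andP[/eqP -> /orP[]/eqP ->].
by rewrite !inE /= => /andP[/orP[]/eqP -> /eqP ->].
Qed.

Local Notation H := (hrel G1 G2 vars_in).
Local Notation V := (vrel G1 G2 vars_in).

(** Induction along the row path, using the three-term relation between the minors of two rows and
    cancelling x_iy, which is outside P. *)
Lemma row_minor2_in i a k l :
  V k i a -> connect (H i) k l -> p_ i a k l \in P.
Proof.
move=> kia kl; have Pid := P_is_ideal; move: l kl.
apply: connect_ind_r => [|y z ky yz IH].
  by rewrite (_ : p_ i a k k = 0) ?(proj1 Pid) // /minor2; ring.
have [_ yia] := connect_grid vars_in_admissible ky (connect1 kia).
have [iyP Gia Gyz] : [/\ x i y \notin P, G1 i a & G2 y z].
  case/existsP: kia => b' /and5P[-> _ _ _ _].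
  by case/existsP: yz => a' /and5P[_ -> iyW _ _]; rewrite inE in iyW.
apply: (P_cancel iyP).
have -> : x i y * p_ i a k z = x i z * p_ i a k y + x i k * p_ i a y z.
  by rewrite /minor2; ring.
apply: is_idealD Pid (is_idealM _ Pid IH) (is_idealM _ Pid _).
exact: edge_minor2_in.
Qed.

(** The same relation for two columns, along the column path; each new minor on adjacent rows comes
    from the row path transported to row y. *)
Lemma same_block_minor2_in i j k l :
  same_block G1 G2 vars_in (i, k) (j, l) -> p_ i j k l \in P.
Proof.
case/andP => /= kl ij; have Pid := P_is_ideal; move: j ij.
apply: connect_ind_r => [|y z iy yz IH].
  by rewrite (_ : p_ i i k l = 0) ?(proj1 Pid) // /minor2; ring.
have [ykl _] := connect_grid vars_in_admissible kl iy.
have ykP : x y k \notin P.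
  by case/existsP: yz => b' /and5P[_ _ ykW _ _]; rewrite inE in ykW.
apply: (P_cancel ykP).
have -> : x y k * p_ i z k l = x z k * p_ i y k l + x i k * p_ y z k l.
  by rewrite /minor2; ring.
apply: is_idealD Pid (is_idealM _ Pid IH) (is_idealM _ Pid _).
exact: row_minor2_in.
Qed.

Lemma PW_vars_in_sub : {subset PW K G1 G2 vars_in <= P}.
Proof.
apply: PW_sub P_is_ideal _ _ => [i j|i j k l ij kl]; first by rewrite inE.
rewrite (mem_Wcompl_hat vars_in_admissible) //.
exact: same_block_minor2_in.
Qed.

End PrimesOverEdgeIdeal.

(** A minor of P_V is either a generator of P_W or has a box with an edge in W. The hypothesis
    negates the criterion of (b) for this V. *)
Lemma PW_subset (V W : {set 'I_m * 'I_n}) : V \subset W ->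
  (forall ef, ef \in Wcompl_hat G1 G2 V :\: Wcompl_hat G1 G2 W ->
    exists2 g, g \in box_edges ef.1 ef.2 & g \subset W) ->
  {subset PW K G1 G2 V <= PW K G1 G2 W}.
Proof.
move=> VW hatVW; apply: PW_sub (PW_is_ideal W) _ _.
  by move=> i j ijV; apply/PW_var/(subsetP VW).
move=> i j k l ij kl efV.
have [|efW] := boolP (([set i; j], [set k; l]) \in Wcompl_hat G1 G2 W).
  exact: PW_minor2.
have [|g gE gW] := hatVW ([set i; j], [set k; l]); first by rewrite inE efW.
exact: PW_box_edge gE gW.
Qed.

Lemma Wcompl_hat_pair W ef : ef \in Wcompl_hat G1 G2 W ->
  exists i j k l, [/\ ef = ([set i; j], [set k; l]), i != j & k != l].
Proof.
case: ef => e f /bigcupP[C _]; rewrite !inE /=.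
case/andP => /andP[_ /cards2P[i [j [ij ->]]]] /andP[_ /cards2P[k [l [kl ->]]]].
by exists i, j, k, l.
Qed.

End BinomialIdeals.

(** * Minimality expressed by comparing the primes P_W *)

Theorem theorem2p7 (K : fieldType) (m n : nat)
    (G1 : sgraph 'I_m) (G2 : sgraph 'I_n)
    (conn1 : connected_graph G1) (conn2 : connected_graph G2) :
  (forall P : {pred {mpoly K[m * n]}},
     minimal_prime_ideal (edge_ideal K G1 G2) P ->
     exists W : {set 'I_m * 'I_n},
       admissible G1 G2 W /\ P =i PW K G1 G2 W)
  /\
  (forall W : {set 'I_m * 'I_n}, admissible G1 G2 W ->
     (minimal_prime_ideal (edge_ideal K G1 G2) (PW K G1 G2 W) <->
      forall V : {set 'I_m * 'I_n}, admissible G1 G2 V -> V \proper W ->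
        exists ef : {set 'I_m} * {set 'I_n},
          ef \in Wcompl_hat G1 G2 V :\: Wcompl_hat G1 G2 W
          /\ forall g, g \in box_edges ef.1 ef.2 -> ~~ (g \subset W))).
Proof.
split=> [P [P_prime JP P_min]|W W_adm].
  (* For W the set of variables in P, the prime P_W lies between the edge ideal and P, so minimality
     gives equality. *)
  have V_adm := vars_in_admissible P_prime JP.
  exists (vars_in P); split=> // p; symmetry.
  apply: P_min; first exact: PW_prime.
    exact: edge_ideal_sub_PW.
  exact: PW_vars_in_sub.
split=> [[_ _ W_min] V V_adm VW|hatW].
  (* Without such a pair P_V is contained in P_W, hence equal to it by minimality; but P_W contains
     a variable outside V. *)
  apply: contrapT => no_ef.
  have VW_sub : {subset PW K G1 G2 V <= PW K G1 G2 W}.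
    apply: PW_subset (proper_sub VW) _ => ef efVW.
    apply: contrapT => no_g; apply: no_ef; exists ef; split=> // g gE.
    by apply/negP => gW; apply: no_g; exists g.
  have EVW := W_min _ (PW_prime K V_adm) (edge_ideal_sub_PW V_adm) VW_sub.
  case/properP: VW => _ [[i j] ijW /negP[]].
  by rewrite -(var_in_PW K V_adm) EVW var_in_PW.
split; [exact: PW_prime | exact: edge_ideal_sub_PW |].
move=> Q Q_prime JQ QW; set V := vars_in Q.
have V_adm : admissible G1 G2 V := vars_in_admissible Q_prime JQ.
have VQ : {subset PW K G1 G2 V <= Q} := PW_vars_in_sub Q_prime JQ.
have [EVW|VnW] := eqVneq V W.
  by move=> p; apply/idP/idP; [apply: QW | rewrite -EVW; apply: VQ].
have VW : V \proper W.
  rewrite properEneq VnW; apply/subsetP => -[i j]; rewrite inE /= => /QW.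
  by rewrite var_in_PW.
(* The minor of this pair lies in P_V, hence in Q and in P_W; as no edge of the box is in W, the
   pair would lie in the completion of W^c. *)
have [ef [/setDP[efV efW] gW]] := hatW V V_adm VW.
have [i [j [k [l [Eef ij kl]]]]] := Wcompl_hat_pair efV.
rewrite {}Eef /= in efV efW gW; case/negP: efW.
apply: (minor2_in_PW (K := K)) gW => //.
exact/QW/VQ/PW_minor2.
Qed.
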